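(* (a) For $x,z\in W$, one has $$xR'z\iff\bigl(\overline{\Phi'_x\cup\Phi_z}=\Phi'_{zx}\text{ and }\Phi'_x\cap\Phi_z=\emptyset\bigr)\iff\Phi_z\,\dot\cup\,\Phi'_x=\Phi'_{zx}.$$ (b) If $xR'z$ then $z\leq x$, $l(x)-l(z)=l(z^{-1}x)$ and $xR'z^{-1}$. (c) The elements of $\mathcal{W}'_\dagger$ (other than perhaps $W$) are finite subgroups of $W$. (d) The elements of $\mathcal{W}'_*$ are (possibly empty) complete meet subsemilattices of $(W,\leq)$. One has $W^{*'}=\emptyset$ if $W$ is infinite, and otherwise $W^{*'}=\{w_S\}$ where $w_S$ is the longest element of $W$. (e) If $L\in\mathcal{W}'_*$, then for any subset $X$ of $L$ which has an upper bound in $W$, its join $x=\bigvee X$ in $W$ is an element of $L$ (and so $x$ is the least upper bound of $X$ in $L$). (f) Let $w\in\mathcal{I}=\mathcal{I}(W):=\{w\in W\mid w^2=1_W\}$. Then $wR'w$. The stable subgroup $\{w\}^{*'\dagger'}$ is a subgroup of $W$ contained in $\{x\in W\mid x\leq w\}$ and containing $w$. The corresponding stable subsemilattice $\{w\}^{*'}$ is contained in $\{x\in W\mid x\geq w\}$ and has $w$ as minimum element. The map $w\mapsto\{w\}^{*'}$ gives an injection $i\colon\mathcal{I}(W)\to\mathcal{W}'_*\setminus\{\emptyset\}$.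
   Context: Setting: $V$ is a real vector space with a symmetric bilinear form $\langle\cdot,\cdot\rangle$ and $\Pi\subseteq V$ is a set (the simple roots, possibly infinite) such that (i) $\Pi$ is positively independent (if a finite sum $\sum_{\alpha\in\Pi}c_\alpha\alpha=0$ with all $c_\alpha\geq 0$, then all $c_\alpha=0$); (ii) $\langle\alpha,\alpha\rangle=1$ for $\alpha\in\Pi$, and $\langle\alpha,\beta\rangle\in\{-\cos(\pi/m)\mid m\in\mathbb{Z}_{\geq 2}\}\cup(-\infty,-1]$ for distinct $\alpha,\beta\in\Pi$. For $\alpha\in V$ with $\langle\alpha,\alpha\rangle=1$, let $s_\alpha(v)=v-2\langle v,\alpha\rangle\alpha$. Then $S=\{s_\alpha\mid\alpha\in\Pi\}$, $W=\langle S\rangle$ is a Coxeter group with Coxeter system $(W,S)$, length function $l$ and identity element $1_W$. The root system is $\Phi=W\Pi$; the positive roots $\Phi_+$ are the roots that are non-negative real linear combinations of $\Pi$; $\Phi_-=-\Phi_+$, and $\Phi$ is the disjoint union of $\Phi_+$ and $\Phi_-$. For $z\in W$, $\Phi_z:=\Phi_+\cap z(\Phi_-)$ and $\Phi'_z:=\Phi_+\setminus\Phi_z$. The weak (right) order on $W$ is defined by $x\leq y$ iff $l(y)=l(x)+l(x^{-1}y)$ (equivalently $\Phi_x\subseteq\Phi_y$). In this order $W$ is a complete meet semilattice (every non-empty subset has a greatest lower bound), and every subset with an upper bound has a least upper bound (join, denoted $\bigvee$). A complete meet subsemilattice of $(W,\leq)$ is a subset $X$ of $W$ such that for any non-empty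 $Y\subseteq X$, the meet (greatest lower bound) $\bigwedge Y$ in $W$ lies in $X$. The symbol $\dot\cup$ indicates a union of disjoint sets. 2-closure: a subset $\Gamma$ of $\Phi$ is closed if for all $\alpha,\beta\in\Gamma$, $\{a\alpha+b\beta\mid a,b\in\mathbb{R}_{\geq0}\}\cap\Phi\subseteq\Gamma$. For $\Gamma\subseteq\Phi$, $\overline{\Gamma}$ is the intersection of all closed subsets of $\Phi$ containing $\Gamma$. Define a relation $R'$ on $W$ by $xR'z$ iff $z(\Phi'_x)=\Phi'_x$. For $X,Z\subseteq W$ let $X^{\dagger'}:=\{z\in W\mid xR'z\text{ for all }x\in X\}$ and $Z^{*'}:=\{x\in W\mid xR'z\text{ for all }z\in Z\}$. Let $\mathcal{W}'_*:=\{Z^{*'}\mid Z\subseteq W\}$ (stable subsemilattices) and $\mathcal{W}'_\dagger:=\{X^{\dagger'}\mid X\subseteq W\}$ (stable subgroups); equivalently, the subsets $L$ with $L^{\dagger'*'}=L$, respectively the subsets $G$ with $G^{*'\dagger'}=G$.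
   Formalization: In (e) the subset X is taken non-empty; for X empty the join is 1_W and the claim fails, e.g. W={1,s}, L={s}^{*'}={s} does not contain 1_W. *)

(* Defs.v *)
From HB Require Import structures.
From mathcomp Require Import all_boot all_order all_algebra.
From mathcomp Require Import finmap.
From mathcomp Require Import all_classical all_reals trigo.

Set Implicit Arguments.
Unset Strict Implicit.
Unset Printing Implicit Defensive.

Import Order.TTheory GRing.Theory Num.Theory.

Local Open Scope classical_set_scope.
Local Open Scope ring_scope.

Record root_datum (R : realType) (V : lmodType R) := RootDatum {
  root_form : {symmetric V};
  simple_roots : set V;
  simple_pos_indep : forall (A : {fset V}) (c : V -> R),
    [set` A] `<=` simple_roots -> (forall a, a \in A -> 0 <= c a) ->
    \sum_(a <- A) c a *: a = 0 -> forall a, a \in A -> c a = 0;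
  simple_norm : forall a, simple_roots a -> root_form a a = 1;
  simple_angle : forall a b, simple_roots a -> simple_roots b -> a <> b ->
    (exists m : nat, (2 <= m)%N /\ root_form a b = - cos (pi / m%:R)) \/
    root_form a b <= -1
}.

Fact weak_display : Order.disp_t. Proof. exact: Order.Disp tt tt. Qed.

Section CoxeterGroup.
Context {R : realType} {V : lmodType R} (D : root_datum V).

Definition reflection (a v : V) : V := v - (2 * root_form D v a) *: a.

Definition reflection_prod (s : seq V) : V -> V :=
  foldr (fun a f => reflection a \o f) id s.

Definition simple_word (s : seq V) : Prop := forall a, a \in s -> simple_roots D a.

(* The generators are involutions, so the monoid they generate under
   composition is already the group they generate. *)
Definition coxeter_group : Type :=
  {w : V -> V | exists2 s, simple_word s & w = reflection_prod s}.

Definition act (w : coxeter_group) : V -> V := sval w.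

HB.instance Definition _ := gen_eqMixin coxeter_group.
HB.instance Definition _ := gen_choiceMixin coxeter_group.

Lemma act_inj : injective act.
Proof.
by move=> [f hf] [g hg] /= e; subst g; congr exist; apply: Prop_irrelevance.
Qed.

Lemma reflK a : simple_roots D a -> involutive (reflection a).
Proof.
move=> Da v; rewrite /reflection linearBl linearZl /= (simple_norm Da) mulr1.
set b := root_form D v a.
have -> : b - 2 * b = - b by rewrite mulr_natl mulr2n opprD addrA subrr add0r.
by rewrite mulrN scaleNr opprK subrK.
Qed.

Lemma simple_word_cat s t :
  simple_word s -> simple_word t -> simple_word (s ++ t).
Proof. by move=> hs ht a; rewrite mem_cat => /orP[/hs|/ht]. Qed.

Lemma simple_word_rev s : simple_word s -> simple_word (rev s).
Proof. by move=> hs a; rewrite mem_rev => /hs. Qed.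

Lemma reflection_prod_cat s t : reflection_prod (s ++ t) = reflection_prod s \o reflection_prod t.
Proof. by elim: s => //= a s ->. Qed.

Lemma reflection_prod_revK s : simple_word s -> reflection_prod (rev s) \o reflection_prod s = id.
Proof.
elim: s => [//|a s IH] hs; rewrite rev_cons -cats1 reflection_prod_cat.
have hs' : simple_word s by move=> b bs; apply: hs; rewrite inE bs orbT.
apply/funext => v /=; rewrite reflK; last by apply: hs; rewrite inE eqxx.
exact: (congr1 (@^~ v) (IH hs')).
Qed.

Lemma cox_one_subproof : exists2 s, simple_word s & id = reflection_prod s.
Proof. by exists [::]. Qed.

Definition cox_one : coxeter_group := exist _ id cox_one_subproof.

Lemma cox_mul_subproof (x y : coxeter_group) :
  exists2 s, simple_word s & act x \o act y = reflection_prod s.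
Proof.
have [s hs es] := svalP x; have [t ht et] := svalP y.
exists (s ++ t); first exact: simple_word_cat.
by rewrite reflection_prod_cat -es -et.
Qed.

Definition cox_mul (x y : coxeter_group) : coxeter_group :=
  exist _ (act x \o act y) (cox_mul_subproof x y).

Definition word_of (w : coxeter_group) : seq V := s2val (cid2 (svalP w)).

Lemma word_ofP w : simple_word (word_of w).
Proof. by rewrite /word_of; case: cid2. Qed.

Lemma word_ofE w : act w = reflection_prod (word_of w).
Proof. by rewrite /word_of; case: cid2. Qed.

Lemma cox_inv_subproof w :
  exists2 s, simple_word s & reflection_prod (rev (word_of w)) = reflection_prod s.
Proof.
by exists (rev (word_of w)); first exact/simple_word_rev/word_ofP.
Qed.

Definition cox_inv (w : coxeter_group) : coxeter_group :=
  exist _ (reflection_prod (rev (word_of w))) (cox_inv_subproof w).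

Lemma cox_mulA : associative cox_mul.
Proof. by move=> x y z; apply: act_inj. Qed.

Lemma cox_mul1 : left_id cox_one cox_mul.
Proof. by move=> x; apply: act_inj. Qed.

Lemma cox_mulr1 : right_id cox_one cox_mul.
Proof. by move=> x; apply: act_inj. Qed.

Lemma cox_mulV : left_inverse cox_one cox_inv cox_mul.
Proof.
move=> x; apply: act_inj; rewrite /act /= -/(act x) word_ofE.
exact/reflection_prod_revK/word_ofP.
Qed.

Lemma cox_mulrV : right_inverse cox_one cox_inv cox_mul.
Proof.
move=> x; apply: act_inj; rewrite /act /= -/(act x) word_ofE.
have := reflection_prod_revK (simple_word_rev (@word_ofP x)).
by rewrite revK.
Qed.

HB.instance Definition _ := isGroup.Build coxeter_group
  cox_mulA cox_mul1 cox_mulr1 cox_mulV cox_mulrV.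

Lemma length_subproof (w : coxeter_group) :
  exists n, `[< exists s, [/\ simple_word s, size s = n & act w = reflection_prod s] >].
Proof.
exists (size (word_of w)); apply/asboolP; exists (word_of w).
by split; [exact: word_ofP| |exact: word_ofE].
Qed.

Definition cox_length (w : coxeter_group) : nat := ex_minn (length_subproof w).

Lemma length_word s (w : coxeter_group) :
  simple_word s -> act w = reflection_prod s -> (cox_length w <= size s)%N.
Proof.
move=> hs e; rewrite /cox_length; case: ex_minnP => n _; apply.
by apply/asboolP; exists s.
Qed.

Lemma lengthP (w : coxeter_group) :
  exists s, [/\ simple_word s, size s = cox_length w & act w = reflection_prod s].
Proof. by rewrite /cox_length; case: ex_minnP => n /asboolP. Qed.

Lemma length1 : cox_length 1%g = 0%N.
Proof. by apply/eqP; rewrite -leqn0; apply: (@length_word [::]). Qed.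

Lemma length_eq0 w : cox_length w = 0%N -> w = 1%g.
Proof.
have [s [_ ss e]] := lengthP w; rewrite -ss => /size0nil s0.
by apply: act_inj; rewrite e s0.
Qed.

Lemma lengthM x y : (cox_length (x * y)%g <= cox_length x + cox_length y)%N.
Proof.
have [s [hs <- es]] := lengthP x; have [t [ht <- et]] := lengthP y.
rewrite -size_cat; apply: length_word; first exact: simple_word_cat.
by rewrite reflection_prod_cat -es -et.
Qed.

Definition weak_le (x y : coxeter_group) : bool :=
  cox_length y == (cox_length x + cox_length (x^-1 * y)%g)%N.

Lemma weak_le_refl : reflexive weak_le.
Proof. by move=> x; rewrite /weak_le mulVg length1 addn0. Qed.

Lemma weak_le_anti : antisymmetric weak_le.
Proof.
move=> x y /andP[/eqP exy /eqP eyx].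
have /length_eq0 e : cox_length (x^-1 * y)%g = 0%N.
  apply/eqP; move: eyx; rewrite exy -addnA -[X in X = _]addn0.
  by move/addnI/esym/eqP; rewrite addn_eq0 => /andP[].
by rewrite -[x]mulg1 -e mulVKg.
Qed.

Lemma weak_le_trans : transitive weak_le.
Proof.
move=> y x z /eqP exy /eqP eyz; rewrite /weak_le eqn_leq; apply/andP; split.
  by rewrite -{1}[z](mulVKg x) lengthM.
rewrite eyz exy -addnA leq_add2l.
by rewrite (_ : x^-1 * z = (x^-1 * y) * (y^-1 * z))%g ?lengthM // -mulgA mulVKg.
Qed.

HB.instance Definition _ := Order.Le_isPOrder.Build weak_display
  coxeter_group weak_le_refl weak_le_anti weak_le_trans.

Definition roots : set V :=
  \bigcup_(w in [set: coxeter_group]) (act w @` simple_roots D).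

Definition pos_comb : set V :=
  [set v | exists (A : {fset V}) (c : V -> R),
    [/\ [set` A] `<=` simple_roots D, forall a, a \in A -> 0 <= c a &
        v = \sum_(a <- A) c a *: a]].

Definition pos_roots : set V := roots `&` pos_comb.

Definition neg_roots : set V := -%R @` pos_roots.

Definition inv_set (z : coxeter_group) : set V :=
  pos_roots `&` (act z @` neg_roots).

Definition coinv_set (z : coxeter_group) : set V := pos_roots `\` inv_set z.

Definition root_closed (G : set V) : Prop :=
  G `<=` roots /\
  forall al be, G al -> G be -> forall a b : R, 0 <= a -> 0 <= b ->
    roots (a *: al + b *: be) -> G (a *: al + b *: be).

Definition root_closure (G : set V) : set V := smallest root_closed G.

Definition stab_rel (x z : coxeter_group) : Prop :=
  act z @` coinv_set x = coinv_set x.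

Definition dagger (X : set coxeter_group) : set coxeter_group :=
  [set z | forall x, X x -> stab_rel x z].

Definition star (Z : set coxeter_group) : set coxeter_group :=
  [set x | forall z, Z z -> stab_rel x z].

Definition stable_subsemilattices : set (set coxeter_group) := range star.

Definition stable_subgroups : set (set coxeter_group) := range dagger.

Definition complete_meet_subsemilattice (X : set coxeter_group) : Prop :=
  forall Y, Y `<=` X -> Y !=set0 -> exists2 m, infimums Y m & X m.

Definition longest (w : coxeter_group) : Prop :=
  forall x, x <> w -> (cox_length x < cox_length w)%N.

Definition involutions : set coxeter_group := [set w | (w * w)%g = 1%g].

End CoxeterGroup.

Arguments roots {R V} D.
Arguments pos_roots {R V} D.
Arguments neg_roots {R V} D.
Arguments stable_subsemilattices {R V} D.
Arguments stable_subgroups {R V} D.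
Arguments involutions {R V} D.

(* Main.v *)
Require Import Defs.
From mathcomp Require Import all_boot all_order all_algebra finmap.
From mathcomp Require Import all_classical all_reals trigo.
From mathcomp Require Import lra zify.

(** Everything is read off from the inversion sets [inv_set z], that is
    [Phi_z]. Four facts about them carry the proof.

    - Every root is positive or negative, and [act w a] is positive for a
      simple root [a] exactly when [w * gen a] is longer than [w]
      ([ascent_pos_comb], [root_pos_neg], [pos_ascent]). Positive independence
      of the simple roots enters through two properties of the cone they span:
      it is pointed ([pos_comb_pointed]), and every simple root spans an extremal
      ray of it ([simple_ray]).
    - [Phi_z] has [cox_length z] elements ([inv_set_enum]), so that [x <= y] if and
      only if [Phi_x] is included in [Phi_y] ([le_inv_set]).
    - [z^-1 <= x] if and only if [Phi_z] and [Phi_(z x)] are disjoint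
      ([le_invP]).
    - A nonempty subset of [W] has a meet ([meet_exists]). The crux is that two
      generators with an upper bound have a join ([gen_join]).

    By definition [x R' z] is a statement about complements of inversion
    sets. A computation with signs of roots turns it into the disjoint union of
    (a) ([stab_rel_union]), and counting inversions turns the latter into three
    inequalities ([stab_rel_le]):
    [x R' z] if and only if [z <= x], [z^-1 <= x] and [z x <= x].
    In this form the rest is order theory. Left translation by [z] preserves
    and reflects the order above [z^-1] ([le_divgl]), so the three inequalities
    pass from the elements of a set to its meet ([star_meet]) and to its join
    ([star_join]), which gives (d) and (e). The elements related to a given [x]
    lie below [x], hence are finite in number ([finite_lower]), which gives (c).
    For an involution [w] the three inequalities trivially hold with
    [x = z = w], and (f) follows. Finally, coinversion sets are closed, which
    makes the closure in (a) harmless ([closure_iff_union]). *)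

Set Implicit Arguments.
Unset Strict Implicit.
Unset Printing Implicit Defensive.

Import Order.TTheory GRing.Theory Num.Theory.

Local Open Scope classical_set_scope.
Local Open Scope ring_scope.

(** * The cone spanned by the simple roots *)

Section RootCone.
Context {R : realType} {V : lmodType R} (D : root_datum V).
Implicit Types (u v a b : V) (c : R).
Local Notation B := (root_form D).
Local Notation C := (pos_comb D).
Local Notation simple := (simple_roots D).

Lemma root_formC u v : B u v = B v u.
Proof. by rewrite hermC expr0 mul1r. Qed.

Lemma root_formD u v w : B (u + v) w = B u w + B v w.
Proof. exact: linearDl. Qed.

Lemma root_formN u v : B (- u) v = - B u v.
Proof. exact: linearNl. Qed.

Lemma root_formZ c u v : B (c *: u) v = c * B u v.
Proof. exact: linearZl. Qed.

Lemma root_formDr u v w : B w (u + v) = B w u + B w v.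
Proof. by rewrite root_formC root_formD !(root_formC _ w). Qed.

Lemma root_formNr u v : B v (- u) = - B v u.
Proof. by rewrite root_formC root_formN root_formC. Qed.

Lemma root_formZr c u v : B v (c *: u) = c * B v u.
Proof. by rewrite root_formC root_formZ root_formC. Qed.

Lemma root_form_sum (I : Type) (r : seq I) (F : I -> V) v :
  B (\sum_(i <- r) F i) v = \sum_(i <- r) B (F i) v.
Proof. exact: linear_sumlz. Qed.

Lemma simple_form_le0 a b : simple a -> simple b -> a <> b -> B a b <= 0.
Proof.
move=> sa sb ab; case: (simple_angle sa sb ab) => [[m [m2 ->]]|]; last by lra.
rewrite oppr_le0 cos_ge0_pihalf //.
have p0 := @pi_gt0 R.
have m2' : (2 : R) <= m%:R by rewrite ler_nat.
have m0 : (0 : R) < m%:R by lra.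
apply/andP; split.
  by apply: (@le_trans _ _ 0); [lra | rewrite divr_ge0 // ltW].
by apply: ler_wpM2l; [exact: ltW | rewrite lef_pV2 ?posrE].
Qed.

Lemma pos_comb0 : C 0.
Proof.
by exists fset0, (fun=> 0); split=> //=; rewrite big_seq_fset0.
Qed.

Lemma pos_combZ c v : 0 <= c -> C v -> C (c *: v).
Proof.
move=> c0 [A [f [As f0 ->]]]; exists A, (fun a => c * f a); split=> //.
  by move=> a aA; rewrite mulr_ge0 // f0.
by rewrite scaler_sumr; apply: eq_bigr => a _; rewrite scalerA.
Qed.

(** Coefficients extended by zero, in order to add combinations with different
    supports. *)
Let ext (A : {fset V}) (f : V -> R) a := if a \in A then f a else 0.

Let ext_ge0 (A : {fset V}) (f : V -> R) :
  (forall a, a \in A -> 0 <= f a) -> forall a, 0 <= ext A f a.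
Proof. by move=> f0 a; rewrite /ext; case: ifP => // /f0. Qed.

Let ext_sum (A A' : {fset V}) (f : V -> R) : (A `<=` A')%fset ->
  \sum_(a <- A) f a *: a = \sum_(a <- A') ext A f a *: a.
Proof.
move=> AA; rewrite -(big_fset_incl _ AA); last first.
  by move=> a _ /negbTE aA; rewrite /ext aA scale0r.
by rewrite !big_seq; apply: eq_bigr => a aA; rewrite /ext aA.
Qed.

Let sum_ext2 (A A' : {fset V}) (f g : V -> R) :
  \sum_(a <- A) f a *: a + \sum_(a <- A') g a *: a =
  \sum_(a <- (A `|` A')%fset) (ext A f a + ext A' g a) *: a.
Proof.
rewrite (ext_sum _ (fsubsetUl A A')) (ext_sum _ (fsubsetUr A A')) -big_split /=.
by apply: eq_bigr => a _; rewrite scalerDl.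
Qed.

Let fsetU_simple (A A' : {fset V}) : [set` A] `<=` simple -> [set` A'] `<=` simple ->
  [set` (A `|` A')%fset] `<=` simple.
Proof. by move=> As As' a /=; rewrite inE => /orP[/As|/As']. Qed.

Lemma pos_combD u v : C u -> C v -> C (u + v).
Proof.
move=> [A [f [As f0 ->]]] [A' [g [As' g0 ->]]].
exists (A `|` A')%fset, (fun a => ext A f a + ext A' g a); split.
- exact: fsetU_simple.
- by move=> a _; rewrite addr_ge0 // ext_ge0.
- exact: sum_ext2.
Qed.

Lemma pos_comb_pointed u v : C u -> C v -> u + v = 0 -> u = 0.
Proof.
move=> [A [f [As f0 ->]]] [A' [g [As' g0 ->]]]; rewrite sum_ext2 => e.
have := simple_pos_indep (fsetU_simple As As') _ e => h.
rewrite big_seq big1 // => a aA.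
have /h : forall a, a \in (A `|` A')%fset -> 0 <= ext A f a + ext A' g a.
  by move=> b _; rewrite addr_ge0 // ext_ge0.
move=> /(_ a); rewrite inE aA => /(_ isT) e0.
have := ext_ge0 g0 a; have := ext_ge0 f0 a; move: e0; rewrite /ext aA => e0 h1 h2.
by rewrite (_ : f a = 0) ?scale0r //; lra.
Qed.

Lemma pos_comb_simple a : simple a -> C a.
Proof.
move=> sa; exists [fset a]%fset, (fun=> 1); split => //.
  by move=> b /=; rewrite inE => /eqP ->.
by rewrite big_seq_fset1 scale1r.
Qed.

(** Distinct simple roots pair nonpositively, so the contribution of the simple
    roots other than [a] pairs nonpositively with [a]. *)
Lemma pos_comb_split a v : simple a -> C v ->
  exists2 c, 0 <= c & exists2 v', C v' /\ B v' a <= 0 & v = c *: a + v'.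
Proof.
move=> sa [A [f [As f0 ->]]].
exists (ext A f a); first exact: ext_ge0.
exists (\sum_(b <- (A `\ a)%fset) f b *: b).
  have sub b : b \in (A `\ a)%fset -> b != a /\ b \in A by rewrite !inE => /andP.
  split.
    exists (A `\ a)%fset, f; split=> // b /sub[_]; [exact: As | exact: f0].
  rewrite root_form_sum big_seq sumr_le0 // => b /sub[/eqP ba bA].
  by rewrite root_formZ mulr_ge0_le0 ?f0 // simple_form_le0 //; apply: As.
rewrite /ext; case: ifP => aA; first exact: big_fsetD1.
by rewrite scale0r add0r mem_fsetD1 ?aA.
Qed.

(** A simple root spans an extremal ray of the cone: pairing with [a] shows
    that no positive multiple of [a] is a combination of other simple roots. *)
Lemma simple_ray a u v c : simple a -> C u -> C v -> u + v = c *: a ->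
  exists2 d, 0 <= d & u = d *: a.
Proof.
move=> sa Cu Cv e.
have [d d0 [u' [Cu' u'a] eu]] := pos_comb_split sa Cu.
have [d' d'0 [v' [Cv' v'a] ev]] := pos_comb_split sa Cv.
have e' : u' + v' = (c - d - d') *: a.
  rewrite !scalerBl -e eu ev.
  by rewrite addrACA [_ + (u' + v')]addrC [d *: a + _]addrC addrA !addrK.
exists d => //; rewrite eu (_ : u' = 0) ?addr0 //.
have [cdd|cdd] := leP (c - d - d') 0.
  have h : C (v' + - (c - d - d') *: a).
    by apply: pos_combD => //; apply: pos_combZ; [lra | exact: pos_comb_simple].
  by apply: (pos_comb_pointed Cu' h); rewrite addrA e' scaleNr subrr.
have : B (u' + v') a <= 0 by rewrite root_formD; lra.
by rewrite e' root_formZ (simple_norm sa) mulr1 leNgt cdd.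
Qed.

Lemma norm1_neq0 v : B v v = 1 -> v <> 0.
Proof. by move=> vv v0; move: vv; rewrite v0 linear0l => /esym/eqP; rewrite oner_eq0. Qed.

Lemma norm1_collinear c a : B a a = 1 -> B (c *: a) (c *: a) = 1 -> 0 <= c -> c = 1.
Proof.
move=> aa; rewrite root_formZ root_formZr aa mulr1 => cc c0.
have : (c - 1) * (c + 1) = 0 by lra.
by move/eqP; rewrite mulf_eq0 => /orP[] /eqP; lra.
Qed.

(** The cone meets the plane of two simple roots in the cone spanned by these
    two: if [y] were negative, [- y b] would be a summand of [x a], hence a
    multiple of [a]. *)
Lemma pos_comb_plane a b x y : simple a -> simple b -> a <> b ->
  C (x *: a + y *: b) -> 0 <= y.
Proof.
move=> sa sb ab Cv; have [//|y0] := leP 0 y.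
have sb' := pos_comb_simple sb.
have Cyb : C (- y *: b) by apply: pos_combZ => //; lra.
have [|d d0 e] := simple_ray sa Cyb Cv (c := x).
  by rewrite scaleNr addrC addrK.
have e1 : b = (d / - y) *: a.
  by rewrite mulrC -scalerA -e scalerA mulVf ?scale1r // oppr_eq0 lt_eqF.
case: ab; move: (simple_norm sb); rewrite {}e1 => e1.
by rewrite (norm1_collinear (simple_norm sa) e1) ?scale1r // divr_ge0 // oppr_ge0 ltW.
Qed.
End RootCone.

(** * Sines of multiples of an angle *)

Section Chebyshev.
Context {R : realType}.
Implicit Types (c t : R) (m k : nat).

(** The value at [c] of the Chebyshev polynomial of the second kind of degree
    [k - 1]: it is [sin (k t) / sin t] when [c = cos t]. *)
Definition cheb c k : R := (iter k (fun p => (p.2, 2 * c * p.2 - p.1)) (0, 1)).1.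

Lemma cheb0 c : cheb c 0 = 0. Proof. by []. Qed.

Lemma cheb1 c : cheb c 1 = 1. Proof. by []. Qed.

Lemma chebS c k : cheb c k.+2 = 2 * c * cheb c k.+1 - cheb c k.
Proof. by rewrite /cheb !iterS. Qed.

Lemma cheb_ge0_hyperbolic c k : 1 <= c -> 0 <= cheb c k.
Proof.
move=> c1; suff : 0 <= cheb c k /\ cheb c k <= cheb c k.+1 by case.
elim: k => [|k [h0 h1]]; first by rewrite cheb0 cheb1; split=> //; lra.
by rewrite chebS; split; nra.
Qed.

Lemma cheb_sin t k : cheb (cos t) k * sin t = sin (k%:R * t).
Proof.
suff : cheb (cos t) k * sin t = sin (k%:R * t) /\
       cheb (cos t) k.+1 * sin t = sin (k.+1%:R * t) by case.
elim: k => [|k [h0 h1]].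
  by rewrite cheb0 cheb1 !mul0r !mul1r sin0.
split=> //; rewrite chebS mulrBl -[X in X - _]mulrA h1 h0.
have -> : k.+2%:R * t = k.+1%:R * t + t by rewrite -[k.+2]addn1 natrD; lra.
have -> : k%:R * t = k.+1%:R * t - t by rewrite -[k.+1]addn1 natrD; lra.
by rewrite sinB sinD; lra.
Qed.

Let sin_pi_gt0 m : (2 <= m)%N -> 0 < sin (pi / m%:R) :> R.
Proof.
move=> m2; have p0 := @pi_gt0 R.
have m2' : (2 : R) <= m%:R by rewrite ler_nat.
have m0 : (0 : R) < m%:R by lra.
by rewrite sin_gt0_pi // divr_gt0 //= ltr_pdivrMr // ltr_pMr //; lra.
Qed.

Lemma cheb_ge0_elliptic m k :
  (2 <= m)%N -> (k <= m)%N -> 0 <= cheb (cos (pi / m%:R)) k.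
Proof.
move=> m2 km; rewrite -(pmulr_lge0 _ (sin_pi_gt0 m2)) cheb_sin.
have m0 : (0 : R) < m%:R by rewrite ltr0n; lia.
have p0 := @pi_gt0 R.
apply: sin_ge0_pi; rewrite mulr_ge0 ?divr_ge0 ?ler0n ?(ltW p0) //=.
by rewrite mulrCA ler_piMr ?(ltW p0) // ler_pdivrMr // mul1r ler_nat.
Qed.

Lemma cheb_order m : (2 <= m)%N ->
  cheb (cos (pi / m%:R)) m = 0 /\ cheb (cos (pi / m%:R)) m.-1 = 1.
Proof.
move=> m2; have s0 := sin_pi_gt0 m2.
have m0 : m%:R != 0 :> R by rewrite pnatr_eq0; lia.
have s0' := lt0r_neq0 s0.
split; apply: (mulIf s0'); rewrite cheb_sin.
  by rewrite mulrCA divff // mulr1 sinpi mul0r.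
rewrite mul1r (_ : m.-1%:R * _ = pi - pi / m%:R).
  by rewrite sinB sinpi cospi mul0r sub0r mulN1r opprK.
rewrite -subn1 natrB; last by lia.
by rewrite mulrBl mulrCA divff // mulr1 mul1r.
Qed.
End Chebyshev.

(** * Lengths and signs of images of simple roots *)

Section Group.
Context {R : realType} {V : lmodType R} (D : root_datum V).
Local Notation W := (coxeter_group D).
Local Notation B := (root_form D).
Local Notation C := (pos_comb D).
Local Notation simple := (simple_roots D).
Local Notation l w := (@cox_length R V D w%g).
Implicit Types (u v a b : V) (c : R) (x y w z : W) (k m n : nat).

Lemma actM x y v : act (x * y)%g v = act x (act y v). Proof. by []. Qed.

Lemma actK x v : act x^-1%g (act x v) = v.
Proof. by rewrite -actM mulVg. Qed.

Lemma actKV x v : act x (act x^-1%g v) = v.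
Proof. by rewrite -actM mulgV. Qed.

Lemma act_ind (P : (V -> V) -> Prop) : P id ->
  (forall a f, simple a -> P f -> P (reflection D a \o f)) ->
  forall w, P (act w).
Proof.
move=> P0 PS w; rewrite word_ofE; elim: (word_of w) (@word_ofP _ _ D w) => //= a s IH h.
apply: PS; first by apply: h; rewrite inE eqxx.
by apply: IH => b bs; apply: h; rewrite inE bs orbT.
Qed.

Lemma actD w u v : act w (u + v) = act w u + act w v.
Proof.
move: u v; apply: (act_ind (P := fun f => forall u v, f (u + v) = f u + f v)) => //.
move=> a f sa IH u v /=; rewrite IH /reflection root_formD mulrDr scalerDl opprD.
by rewrite addrACA.
Qed.

Lemma actZ w c v : act w (c *: v) = c *: act w v.
Proof.
move: v; apply: (act_ind (P := fun f => forall v, f (c *: v) = c *: f v)) => //.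
move=> a f sa IH v /=; rewrite IH /reflection root_formZ scalerBr scalerA.
by congr (_ - _ *: _); lra.
Qed.

Lemma actN w v : act w (- v) = - act w v.
Proof. by rewrite -!scaleN1r actZ. Qed.

Lemma act_form w u v : B (act w u) (act w v) = B u v.
Proof.
move: u v; apply: (act_ind (P := fun f => forall u v, B (f u) (f v) = B u v)) => //.
move=> a f sa IH u v /=; rewrite /reflection.
rewrite !(root_formD, root_formDr, root_formN, root_formNr, root_formZ,
  root_formZr) (simple_norm sa) IH.
by rewrite (root_formC _ a (f v)); lra.
Qed.

Let gen_subproof a (sa : simple a) :
  exists2 s, simple_word D s & reflection D a = reflection_prod D s.
Proof. by exists [:: a] => // b; rewrite inE => /eqP ->. Qed.

(** Made total by the value [1] off the simple roots, so that words can be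
    manipulated without carrying proofs of membership. *)
Definition gen a : W :=
  if pselect (simple a) is left sa then exist _ (reflection D a) (gen_subproof sa)
  else 1%g.

Lemma genE a : simple a -> act (gen a) = reflection D a.
Proof. by rewrite /gen; case: pselect. Qed.

Lemma genK a : (gen a * gen a)%g = 1%g.
Proof.
have [sa|sa] := pselect (simple a).
  by apply: act_inj; apply/funext => v; rewrite actM genE // reflK.
by rewrite /gen; case: pselect => //; rewrite mulg1.
Qed.

Lemma genV a : (gen a)^-1%g = gen a.
Proof. by apply: (mulgI (gen a)); rewrite genK mulgV. Qed.

Lemma genMK a x : (gen a * (gen a * x))%g = x.
Proof. by rewrite mulgA genK mul1g. Qed.

Lemma mulgenK a x : (x * gen a * gen a)%g = x.
Proof. by rewrite -mulgA genK mulg1. Qed.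

Lemma act_gen a v : simple a -> act (gen a) v = v - (2 * B v a) *: a.
Proof. by move=> sa; rewrite genE. Qed.

Lemma act_gen_self a : simple a -> act (gen a) a = - a.
Proof.
move=> sa; rewrite act_gen // (simple_norm sa) mulr1 scaler_nat.
by rewrite mulr2n opprD addrA subrr sub0r.
Qed.

(** Both sides are the reflection in the root [act x a]. *)
Lemma conj_gen x y a b : simple a -> simple b -> act x a = act y b ->
  (x * gen a * x^-1 = y * gen b * y^-1)%g.
Proof.
have conj z e : simple e ->
    act (z * gen e * z^-1)%g = fun v => v - (2 * B v (act z e)) *: act z e.
  move=> se; apply/funext => v; rewrite !actM act_gen // actD actN actZ actKV.
  by rewrite -(act_form z) actKV.
by move=> sa sb e; apply: act_inj; rewrite !conj // e.
Qed.

Lemma lengthV x : l x^-1%g = l x.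
Proof.
suff le y : (l y^-1%g <= l y)%N.
  by apply/eqP; rewrite eqn_leq le -{1}[x]invgK le.
have [s [hs <- es]] := lengthP y.
rewrite -(size_rev s); apply: length_word; first exact: simple_word_rev.
apply/funext => v; rewrite -[LHS](congr1 (@^~ _) (reflection_prod_revK hs)) /=.
by rewrite -es actKV.
Qed.

Lemma length_gen a : (l (gen a) <= 1)%N.
Proof.
have [sa|sa] := pselect (simple a); last first.
  by rewrite /gen; case: pselect => // _; rewrite length1.
apply: (@length_word _ _ _ [:: a]); last exact: genE.
by move=> b; rewrite inE => /eqP ->.
Qed.

Lemma length_mulgen w a : (l (w * gen a) <= (l w).+1)%N.
Proof. by have := lengthM w (gen a); have := length_gen a; lia. Qed.

Lemma left_descent w : w <> 1%g ->
  exists2 a, simple a & l w = (l (gen a * w)).+1.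
Proof.
have [[|a s] [hs ss es]] := lengthP w => w1.
  by case: w1; apply: act_inj; rewrite es.
have sa : simple a by apply: hs; rewrite inE eqxx.
exists a => //.
have : (l (gen a * w) <= size s)%N.
  apply: length_word; first by move=> b bs; apply: hs; rewrite inE bs orbT.
  by apply/funext => v; rewrite actM es /= -(genE sa) -actM genK.
have := lengthM (gen a) (gen a * w)%g; rewrite genMK -ss /=.
by have := length_gen a; lia.
Qed.

Lemma right_descent w : w <> 1%g ->
  exists2 a, simple a & l w = (l (w * gen a)).+1.
Proof.
move=> w1; have [|a sa e] := @left_descent w^-1%g.
  by move=> h; apply: w1; rewrite -[w]invgK h invg1.
by exists a => //; rewrite -(lengthV w) e -(lengthV (w * _)%g) invgM genV.
Qed.

(** One step of stripping from the right of a group element the letters of an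
    alternating word in two generators; the last component is the root of
    the letter to strip next. *)
Definition peel (p : W * V * V) : W * V * V :=
  ((p.1.1 * gen p.2)%g, p.2, p.1.2).

Section Peel.
Variables (w : W) (a b : V).
Hypotheses (sa : simple a) (sb : simple b).
Local Notation st k := (iter k peel (w, a, b)).
Local Notation u_ k := (st k).1.1.
Local Notation d_ k := (st k).1.2.
Local Notation g_ k := (st k).2.
Local Notation q := (cheb (- B a b)).

Lemma peel_simple k : [/\ simple (d_ k), simple (g_ k) & B (g_ k) (d_ k) = B a b].
Proof.
by elim: k => [|k [IH1 IH2 IH3]]; split=> //=; rewrite root_formC.
Qed.

(** The coefficients obey the Chebyshev recursion because
    [s_g d = d - 2 B(d, g) g]. *)
Lemma peel_act k : act w a = q k.+1 *: act (u_ k) (d_ k) + q k *: act (u_ k) (g_ k).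
Proof.
have step p c0 c1 : simple p.1.2 -> simple p.2 -> B p.2 p.1.2 = B a b ->
    c1 *: act p.1.1 p.1.2 + c0 *: act p.1.1 p.2 =
    (2 * (- B a b) * c1 - c0) *: act (peel p).1.1 (peel p).1.2 +
    c1 *: act (peel p).1.1 (peel p).2.
  case: p => [[u d] g]; rewrite /peel [_.1.1]/= [_.1.2]/= [_.2]/= => sd sg e.
  rewrite !actM act_gen_self // act_gen // [B d g]root_formC e actD !actN actZ.
  rewrite scalerBr scalerA scalerN -scaleNr addrCA -scalerBl.
  by congr (_ + _ *: _); lra.
elim: k => [|k ->]; first by rewrite scale1r scale0r addr0.
by have [sd sg e] := peel_simple k; rewrite chebS -step.
Qed.

Lemma peel_length k : (l ((u_ k)^-1 * w) <= k)%N.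
Proof.
elim: k => [|k]; first by rewrite mulVg length1.
rewrite iterS; case: (iter k peel _) => [[u d] g] /= IH.
rewrite invgM genV -mulgA; apply: leq_trans (lengthM _ _) _.
exact: leq_add (length_gen g) IH.
Qed.
End Peel.

(** Strip from [w] an alternating word in the generators of [a] and of a
    right descent [b] as long as the length drops. What is left sends both
    [a] and [b] into the cone by induction, so it remains to see that the two
    Chebyshev coefficients are nonnegative. They can fail to be so only if
    [B a b = - cos (pi / m)] and at least [m] letters were stripped; but after
    [m - 1] steps the coefficients are 0 and 1, whence a braid relation showing
    that [w * gen a] is shorter than [w]. *)
Lemma ascent_pos_comb w a : simple a -> (l w <= l (w * gen a))%N -> C (act w a).
Proof.
have [n] := ubnP (l w); elim: n w a => // n IH w a ln sa asc.
have [->|w1] := pselect (w = 1%g); first exact: pos_comb_simple.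
have [b sb eb] := right_descent w1.
have ab : a <> b by move=> e; move: asc; rewrite e; lia.
pose st k := iter k peel (w, a, b); pose u k := (st k).1.1.
have stop : exists k, (l (u k) <= l (u k.+1))%N.
  apply: contrapT => h.
  have drop k : (l (u k) + k <= l w)%N.
    elim: k => [|k IHk]; first by rewrite addn0.
    have : (l (u k.+1) < l (u k))%N by rewrite ltnNge; apply/negP => hk; apply: h; exists k.
    by lia.
  by have := drop (l w).+1; lia.
case: (ex_minnP stop) => k stop_k k_min.
have drop j : (j <= k)%N -> (l (u j) + j <= l w)%N.
  elim: j => [|j IHj] jk; first by rewrite addn0.
  have : ~~ (l (u j) <= l (u j.+1))%N by apply/negP => /k_min; lia.
  by have := IHj (ltnW jk); lia.
case: k stop_k k_min drop => [|k] stop_k k_min drop.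
  by move: stop_k; rewrite /u /=; lia.
have [sd sg _] := peel_simple w sa sb k.+1.
have lu : (l (u k.+1) < n)%N by have := drop _ (leqnn _); lia.
have Cg : C (act (u k.+1) (st k.+1).2) by apply: IH.
have Cd : C (act (u k.+1) (st k.+1).1.2).
  apply: IH => //; rewrite [X in (_ <= l X)%N](_ : _ = u k); last by rewrite /u /= mulgenK.
  by have := k_min k; lia.
rewrite (peel_act w sa sb k.+1); case: (simple_angle sa sb ab) => [[m [m2 e]]|e]; last first.
  by apply: pos_combD; apply: pos_combZ => //; apply: cheb_ge0_hyperbolic; lra.
rewrite e opprK.
have [km|mk] := ltnP k.+1 m.
  by apply: pos_combD; apply: pos_combZ => //; apply: cheb_ge0_elliptic => //; lia.
(* At least [m] letters were stripped: the braid relation applies. *)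
case: m m2 e mk => // m m2 e mk.
have [sd' sg' _] := peel_simple w sa sb m.
have := peel_act w sa sb m; rewrite e opprK.
have [-> /= ->] := @cheb_order R _ m2; rewrite scale0r scale1r add0r => braid.
have /(congr1 (fun x => x * w)%g) := conj_gen sa sg' braid.
rewrite mulgVK -[RHS]mulgA => ew.
have := lengthM (u m.+1) ((u m)^-1 * w)%g.
rewrite [X in (l X <= _)%N](_ : _ = (w * gen a)%g); last exact: esym.
have := peel_length w a b m; have := drop _ mk; rewrite -/st -/(u m).
lia.
Qed.
End Group.

(** * Inversion sets *)

Section Roots.
Context {R : realType} {V : lmodType R} (D : root_datum V).
Local Notation W := (coxeter_group D).
Local Notation B := (root_form D).
Local Notation C := (pos_comb D).
Local Notation simple := (simple_roots D).
Local Notation root := (Defs.roots D).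
Local Notation l w := (@cox_length R V D w%g).
Implicit Types (u v a b : V) (c : R) (x y w z : W) (k m n : nat).

Lemma simple_root a : simple a -> root a.
Proof. by move=> sa; exists 1%g => //; exists a. Qed.

Lemma root_act w v : root v -> root (act w v).
Proof. by move=> [x _ [a sa <-]]; exists (w * x)%g => //; exists a. Qed.

Lemma root_opp v : root v -> root (- v).
Proof.
move=> [x _ [a sa <-]]; exists (x * gen D a)%g => //; exists a => //.
by rewrite actM act_gen_self // actN.
Qed.

Lemma root_norm1 v : root v -> B v v = 1.
Proof. by move=> [x _ [a sa <-]]; rewrite act_form simple_norm. Qed.

Lemma root_pos_neg v : root v -> C v \/ C (- v).
Proof.
move=> [w _ [a sa <-]].
have [h|h] := leqP (l w) (l (w * gen D a)); first by left; apply: ascent_pos_comb.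
right; rewrite -actN -(act_gen_self sa) -actM.
by apply: ascent_pos_comb => //; rewrite mulgenK ltnW.
Qed.

Lemma root_not_pos_neg v : root v -> C v -> ~ C (- v).
Proof.
move=> rv Cv CNv; apply: (norm1_neq0 (root_norm1 rv)).
by apply: (pos_comb_pointed Cv CNv); rewrite subrr.
Qed.

Lemma pos_ascent w a : simple a -> C (act w a) -> l (w * gen D a) = (l w).+1.
Proof.
move=> sa Cwa; apply/eqP; rewrite eqn_leq length_mulgen /= ltnNge.
apply/negP => h; apply: (root_not_pos_neg (root_act w (simple_root sa)) Cwa).
rewrite -actN -(act_gen_self sa) -actM.
by apply: ascent_pos_comb => //; rewrite mulgenK.
Qed.

(** A generator makes only one positive root negative. *)
Lemma gen_pos a v : simple a -> root v -> C v -> v <> a -> C (act (gen D a) v).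
Proof.
move=> sa rv Cv va; have [//|CN] := root_pos_neg (root_act (gen D a) rv).
have [|d d0 e] := simple_ray sa Cv CN (c := 2 * B v a).
  by rewrite act_gen // opprB addrC subrK.
case: va; have := root_norm1 rv; rewrite e => e1.
by rewrite (norm1_collinear (simple_norm sa) e1 d0) scale1r.
Qed.

Lemma inv_setP z v : inv_set z v <-> [/\ root v, C v & C (- act z^-1%g v)].
Proof.
split=> [[[rv Cv] [u [t [rt Ct] <-] e]]|[rv Cv Cz]].
  by split=> //; rewrite -e actK opprK.
split=> //; exists (act z^-1%g v); last exact: actKV.
exists (- act z^-1%g v); last exact: opprK.
by split=> //; apply/root_opp/root_act.
Qed.

Lemma coinv_setP z v : coinv_set z v <-> [/\ root v, C v & C (act z^-1%g v)].
Proof.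
split=> [[[rv Cv] /inv_setP nz]|[rv Cv Cz]].
  split=> //; have [//|Cz] := root_pos_neg (root_act z^-1%g rv).
  by case: nz.
by split=> // /inv_setP[_ _]; apply/root_not_pos_neg/Cz/root_act.
Qed.

Lemma coinv_setN z v : root v -> C v -> ~ inv_set z v -> coinv_set z v.
Proof. by move=> rv Cv nz; split. Qed.

(** Passing from [w] to a longer [s_a w] applies [s_a] to the inversions of [w]
    and adds [a]. *)
Lemma inv_set_enum w :
  exists s : seq V, [/\ uniq s, size s = l w & forall v, inv_set w v <-> v \in s].
Proof.
have [n] := ubnP (l w); elim: n w => // n IH w ln.
have [->|w1] := pselect (w = 1%g).
  exists [::]; split=> //=; first by rewrite length1.
  by move=> v; split=> // /inv_setP[rv Cv]; rewrite invg1 => /(root_not_pos_neg rv Cv).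
have [a sa e] := left_descent w1.
set x := (gen D a * w)%g in e; have ew : w = (gen D a * x)%g by rewrite genMK.
have Cxa : C (act x^-1%g a).
  apply: ascent_pos_comb => //; rewrite -[(_ * _)%g]invgK lengthV invgM invgK genV.
  by rewrite -ew lengthV; lia.
have [s [us ss hs]] := IH x ltac:(lia).
have ga2 v : act (gen D a) (act (gen D a) v) = v by rewrite -actM genK.
have actw v : act w^-1%g v = act x^-1%g (act (gen D a) v) by rewrite ew invgM genV.
have na v : inv_set x v -> v <> a.
  move=> /inv_setP[rv _ CN] va; move: CN; rewrite va.
  by apply/root_not_pos_neg/Cxa/root_act/simple_root.
exists (a :: map (act (gen D a)) s); split=> /=; last 1 first.
- move=> v; rewrite inE; split=> [/inv_setP[rv Cv]|/orP[/eqP ->|/mapP[u /hs xu ->]]].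
  + rewrite actw => Cw; have [//|/eqP va] := eqVneq v a.
    apply/mapP; exists (act (gen D a) v) => //; apply/hs/inv_setP.
    by split=> //; [exact: root_act | exact: gen_pos].
  + apply/inv_setP; split; [exact: simple_root | exact: pos_comb_simple |].
    by rewrite actw act_gen_self // actN opprK.
  + have /inv_setP[ru Cu CN] := xu; apply/inv_setP; split.
    * exact: root_act.
    * exact/gen_pos/na.
    * by rewrite actw ga2.
- rewrite (map_inj_uniq (can_inj ga2)) us andbT; apply/negP => /mapP[u /hs].
  move=> /inv_setP[ru Cu _] /(congr1 (act (gen D a))); rewrite ga2 act_gen_self // => eu.
  by apply: (root_not_pos_neg (simple_root sa) (pos_comb_simple sa)); rewrite eu.
- by rewrite size_map ss e.
Qed.

Lemma leE x y : (x <= y)%O = (l y == l x + l (x^-1 * y))%N.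
Proof. by []. Qed.

(** Inversions of [y] are inversions of [x] or come from inversions of
    [x^-1 y], so a count of cardinalities turns the length condition into an
    inclusion. *)
Lemma le_inv_set x y : (x <= y)%O <-> inv_set x `<=` inv_set y.
Proof.
have [s [us ss hs]] := inv_set_enum x; have [t [ut st ht]] := inv_set_enum y.
have [r [ur sr hr]] := inv_set_enum (x^-1 * y)%g.
have act_xy v : act (x^-1 * y)^-1%g (act x^-1%g v) = act y^-1%g v.
  by rewrite -actM invgM invgK mulgK.
rewrite leE; split=> [/eqP e|sub].
  have sz : (size (s ++ map (act x) r) <= size t)%N.
    by rewrite size_cat size_map ss sr st e.
  have sub : {subset t <= s ++ map (act x) r}.
    move=> v /ht/inv_setP[rv Cv CN]; rewrite mem_cat; apply/orP.
    have [Cx|CNx] := root_pos_neg (root_act x^-1%g rv); [right|left].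
      apply/mapP; exists (act x^-1%g v); last by rewrite actKV.
      by apply/hr/inv_setP; split=> //; [exact: root_act | rewrite act_xy].
    exact/hs/inv_setP.
  move=> v /hs vs; apply/ht.
  by rewrite (uniq_min_size ut sub sz).2 mem_cat vs.
have acti : injective (act x) by exact: can_inj (actK x).
have mapr v : v \in map (act x) r -> inv_set y v /\ ~ inv_set x v.
  move=> /mapP[u /hr/inv_setP[ru Cu CN] ->].
  move: CN; rewrite -{1}[u](actK x) act_xy => CN.
  have nx : ~ inv_set x (act x u).
    by move=> /inv_setP[_ _]; rewrite actK => /(root_not_pos_neg ru Cu).
  split=> //; apply/inv_setP; split=> //; first exact: root_act.
  have [//|CNx] := root_pos_neg (root_act x ru).
  have : inv_set x (- act x u).
    by apply/inv_setP; split=> //; [exact/root_opp/root_act | rewrite actN actK opprK].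
  move=> /sub/inv_setP[_ _]; rewrite actN opprK => Cy.
  by case: (root_not_pos_neg (root_act _ (root_act x ru)) Cy CN).
rewrite eqn_leq; apply/andP; split.
  by rewrite -{1}[y](mulVKg x) lengthM.
rewrite -ss -sr -st -(size_map (act x) r) -size_cat; apply: uniq_leq_size.
  rewrite cat_uniq us (map_inj_uniq acti) ur andbT /=.
  by apply/hasPn => v /mapr[_ nx]; apply/negP => /hs.
by move=> v; rewrite mem_cat => /orP[/hs/sub/ht|/mapr[/ht]].
Qed.

(** The map [v |-> - z^-1 v] is a bijection from the inversions of [z] onto those
    of [z^-1]. It matches the inversions of [z] that are inversions of [z x]
    with the inversions of [z^-1] that are not inversions of [x]. *)
Lemma le_invP x z :
  (z^-1%g <= x)%O <-> inv_set z `&` inv_set (z * x)%g = set0.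
Proof.
rewrite le_inv_set; split=> [sub|dis].
  rewrite -subset0 => v [/inv_setP[rv Cv CN] /inv_setP[_ _]].
  rewrite invgM actM => CNx; have : inv_set z^-1%g (- act z^-1%g v).
    apply/inv_setP; split=> //; first exact/root_opp/root_act.
    by rewrite invgK actN actKV opprK.
  move=> /sub/inv_setP[_ _]; rewrite actN opprK.
  by move=> Cx; apply: root_not_pos_neg Cx CNx; do 2!apply: root_act.
move=> v /inv_setP[rv Cv]; rewrite invgK => CN.
have [Cx|CNx] := root_pos_neg (root_act x^-1%g rv); last exact/inv_setP.
exfalso; suff : set0 (- act z v) by [].
rewrite -dis; split; apply/inv_setP; (split; first exact/root_opp/root_act) => //.
  by rewrite actN actK opprK.
by rewrite invgM actM !actN actK opprK.
Qed.
End Roots.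

(** * Meets and joins in the weak order *)

Section WeakOrder.
Context {R : realType} {V : lmodType R} (D : root_datum V).
Local Notation W := (coxeter_group D).
Local Notation B := (root_form D).
Local Notation C := (pos_comb D).
Local Notation simple := (simple_roots D).
Local Notation root := (Defs.roots D).
Local Notation gen := (gen D).
Local Notation l w := (@cox_length R V D w%g).
Implicit Types (v a b : V) (c : R) (u x y w z p m : W) (k n : nat).

Lemma le_length x y : (x <= y)%O -> (l x <= l y)%N.
Proof. by rewrite leE => /eqP ->; exact: leq_addr. Qed.

Lemma le_length_eq x y : (x <= y)%O -> (l y <= l x)%N -> x = y.
Proof.
rewrite leE => /eqP e yx; rewrite -[LHS]mulg1.
rewrite -(@length_eq0 _ _ _ (x^-1 * y)%g); last by lia.
by rewrite mulVKg.
Qed.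

(** Adding [l z] to both lengths turns one defining equation into the other,
    because [x^-1 y] is unchanged when [x] and [y] are translated. *)
Lemma le_divgl z x y : (z <= x)%O -> (z <= y)%O ->
  ((z^-1 * x)%g <= (z^-1 * y)%g)%O = (x <= y)%O :> bool.
Proof.
rewrite !leE => /eqP ex /eqP ey; rewrite ex ey.
by rewrite invgM invgK -mulgA mulVKg -addnA eqn_add2l.
Qed.

(** Concatenating reduced words for [z], [x] and [x^-1 z^-1 y] gives a reduced
    word for [y], so its prefixes are reduced. *)
Lemma le_mulg z x y : (z <= y)%O -> (x <= (z^-1 * y)%g)%O -> (z <= (z * x)%g)%O.
Proof.
rewrite !leE mulKg => /eqP ey /eqP ex.
have := lengthM z x; have := lengthM (z * x)%g (x^-1 * (z^-1 * y))%g.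
by rewrite -mulgA mulVKg mulVKg; lia.
Qed.

Lemma le_mulg_le z x y : (z <= y)%O -> (x <= (z^-1 * y)%g)%O -> ((z * x)%g <= y)%O.
Proof.
by move=> zy h; rewrite -(le_divgl (le_mulg zy h) zy) mulKg.
Qed.

Lemma gen_le w a : simple a -> (gen a <= w)%O <-> inv_set w a.
Proof.
move=> sa; rewrite le_inv_set.
have ra := simple_root sa; have Ca := pos_comb_simple sa.
split=> [|wa v /inv_setP[rv Cv]].
  by apply; apply/inv_setP; split=> //; rewrite genV act_gen_self // opprK.
rewrite genV => CN; have [->//|/eqP va] := eqVneq v a.
by case: (root_not_pos_neg (root_act _ rv) (gen_pos sa rv Cv va) CN).
Qed.

Lemma exists_gen_le w : w <> 1%g -> exists2 a, simple a & (gen a <= w)%O.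
Proof.
move=> /left_descent[a sa e]; exists a => //.
rewrite leE genV e -[gen a]mul1g (pos_ascent (w := 1%g)) ?length1 //.
exact: pos_comb_simple.
Qed.

(** A longest element among those [p] that preserve the plane spanned by [a] and
    [b] and whose inversions lie in the cone spanned by [a] and [b] sends both
    [a] and [b] to negative roots, since otherwise it could be extended.
    Hence [a] and [b] are inversions of [p]. Inversion sets are closed under
    positive combinations, so every upper bound of the two generators is above
    [p]; this also bounds the length of [p]. *)
Lemma gen_join y0 a b : simple a -> simple b -> a <> b ->
  (gen a <= y0)%O -> (gen b <= y0)%O ->
  exists p, [/\ (gen a <= p)%O, (gen b <= p)%O &
    forall y, (gen a <= y)%O -> (gen b <= y)%O -> (p <= y)%O].
Proof.
move=> sa sb ab ay0 by0.
pose span v := exists c d : R, v = c *: a + d *: b.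
pose cone v := exists c d : R, [/\ 0 <= c, 0 <= d & v = c *: a + d *: b].
have span_cone v : span v -> C v -> cone v.
  move=> [c [d ->]] Cv; exists c, d; split=> //.
    by apply: (pos_comb_plane sb sa (nesym ab)); rewrite addrC; exact: Cv.
  exact: pos_comb_plane sa sb ab Cv.
have spana : span a by exists 1, 0; rewrite scale1r scale0r addr0.
have spanb : span b by exists 0, 1; rewrite scale1r scale0r add0r.
have spanB v t c : span v -> span t -> span (v - c *: t).
  move=> [d [e ->]] [f [g ->]]; exists (d - c * f), (e - c * g).
  by rewrite scalerDr !scalerA opprD addrACA -!scalerBl.
have spanN v : span v -> span (- v).
  by move=> [d [e ->]]; exists (- d), (- e); rewrite !scaleNr opprD.
pose ab_ e := e = a \/ e = b.
pose good p := (forall v, inv_set p v -> cone v) /\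
  (forall e, ab_ e -> span (act p e) /\ span (act p^-1%g e)).
have simple_ab e : ab_ e -> simple e by case=> ->.
have good_le p y : good p -> (gen a <= y)%O -> (gen b <= y)%O -> (p <= y)%O.
  move=> [pc _] /(gen_le _ sa)/inv_setP[_ _ Na] /(gen_le _ sb)/inv_setP[_ _ Nb].
  apply/le_inv_set => v pv; have /inv_setP[rv Cv _] := pv.
  apply/inv_setP; split=> //; have [c [d [c0 d0 ->]]] := pc v pv.
  by rewrite actD !actZ opprD -!scalerN; apply: pos_combD; apply: pos_combZ.
have ex : exists n, `[< exists2 p, good p & l p = n >].
  exists 0%N; apply/asboolP; exists 1%g; last exact: length1.
  split=> [v /inv_setP[rv Cv]|e].
    by rewrite invg1 => /(root_not_pos_neg rv Cv).
  by rewrite invg1; case=> ->.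
have bd n : `[< exists2 p, good p & l p = n >] -> (n <= l y0)%N.
  by move=> /asboolP[p gp <-]; apply/le_length/good_le.
case: (ex_maxnP ex bd) => n /asboolP[p gp lp] p_max.
have max q : good q -> (l q <= l p)%N.
  by move=> gq; rewrite lp; apply: p_max; apply/asboolP; exists q.
have [pc ps] := gp.
have neg e : ab_ e -> C (- act p e).
  move=> abe; have se := simple_ab _ abe.
  have [Cpe|//] := root_pos_neg (root_act p (simple_root se)).
  suff /max : good (p * gen e)%g by rewrite (pos_ascent se Cpe) ltnn.
  split=> [v /inv_setP[rv Cv]|f abf].
    rewrite invgM genV actM => CN.
    have [Cpv|CNpv] := root_pos_neg (root_act p^-1%g rv); last exact/pc/inv_setP.
    have [epv|/eqP epv] := eqVneq (act p^-1%g v) e.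
      apply: span_cone => //; rewrite -(actKV p v) epv; exact: (ps e abe).1.
    have rpv := root_act p^-1%g rv.
    by case: (root_not_pos_neg (root_act _ rpv) (gen_pos se rpv Cpv epv) CN).
  rewrite invgM genV !actM !act_gen // actD actN actZ.
  split; apply: spanB; [exact: (ps f abf).1 | exact: (ps e abe).1 | exact: (ps f abf).2 |].
  by case: abe => ->.
have inv e : ab_ e -> inv_set p e.
  move=> abe; have re := simple_root (simple_ab _ abe).
  have Ce := pos_comb_simple (simple_ab _ abe).
  apply/inv_setP; split=> //; have [Cp|//] := root_pos_neg (root_act p^-1%g re).
  have [c [d [c0 d0 ecd]]] := span_cone _ (ps e abe).2 Cp.
  case: (root_not_pos_neg re Ce); rewrite -(actKV p e) ecd actD !actZ opprD -!scalerN.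
  by apply: pos_combD; apply: pos_combZ => //; apply: neg; [left|right].
exists p; split; [apply/gen_le/inv => //; by left | apply/gen_le/inv => //; by right |].
by move=> y; apply: good_le.
Qed.

(** Induction on the length of an element of [Y]. A lower bound [z] of maximal
    length is the meet: a lower bound sharing a left descent with [z] is handled
    by dividing everything by that generator, and the join of two generators
    reduces every other lower bound to that case. *)
Lemma meet_exists (Y : set W) : Y !=set0 -> infimums Y !=set0.
Proof.
move=> [y0 Yy0]; have [n] := ubnP (l y0); elim: n Y y0 Yy0 => // n IH Y y0 Yy0 ln.
have ex : exists k, `[< exists2 z, lbound Y z & l z = k >].
  exists 0%N; apply/asboolP; exists 1%g; last exact: length1.
  by move=> y _; rewrite leE length1 invg1 mul1g.
have bd k : `[< exists2 z, lbound Y z & l z = k >] -> (k <= l y0)%N.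
  by move=> /asboolP[z zY <-]; apply/le_length/zY.
case: (ex_maxnP ex bd) => k /asboolP[z zY lz] z_max.
have max u : lbound Y u -> (z <= u)%O -> u = z.
  move=> uY zu; apply/esym/(le_length_eq zu); rewrite lz.
  by apply: z_max; apply/asboolP; exists u.
have share u a : simple a -> lbound Y u -> (gen a <= u)%O -> (gen a <= z)%O ->
    (u <= z)%O.
  move=> sa uY au az.
  have aY y : Y y -> (gen a <= y)%O by move=> /uY; apply: le_trans au.
  have [||m [mY m_max]] := IH [set (gen a)^-1 * y | y in Y]%g ((gen a)^-1 * y0)%g.
  - by exists y0.
  - move: (aY _ Yy0) ln; rewrite leE => /eqP.
    rewrite -[X in (_ = l X + _)%N]mul1g (pos_ascent (w := 1%g)) ?length1 //.
      by lia.
    exact: pos_comb_simple.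
  have le_m w : lbound Y w -> (gen a <= w)%O -> (w <= (gen a * m)%g)%O.
    move=> wY aw; have h : (((gen a)^-1 * w)%g <= m)%O.
      by apply: m_max => _ [y Yy <-]; rewrite le_divgl //; [exact: wY | exact: aY].
    have ma : (m <= ((gen a)^-1 * y0)%g)%O by apply: mY; exists y0.
    by rewrite -(le_divgl aw (le_mulg (aY _ Yy0) ma)) mulKg.
  rewrite -(max (gen a * m)%g); [exact: le_m | | exact: le_m].
  by move=> y Yy; apply: le_mulg_le; [exact: aY | apply: mY; exists y].
exists z; split=> // u uY.
have [->|u1] := pselect (u = 1%g).
  by rewrite leE length1 invg1 mul1g.
have [a sa au] := exists_gen_le u1.
have lb_gen w e : lbound Y w -> (gen e <= w)%O -> forall y, Y y -> (gen e <= y)%O.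
  by move=> wY ew y /wY; apply: le_trans.
have [z1|z1] := pselect (z = 1%g).
  suff ga : gen a = z by apply: (share u a) => //; rewrite ga.
  by apply: max; [exact: lb_gen au | rewrite z1 leE length1 invg1 mul1g].
have [b sb bz] := exists_gen_le z1.
have [eab|ab] := pselect (a = b); first by apply: (share u a) => //; rewrite eab.
have [p [ap bp pmin]] :=
  gen_join sa sb ab (lb_gen _ _ uY au _ Yy0) (lb_gen _ _ zY bz _ Yy0).
have pz : (p <= z)%O.
  apply: (share p b) => // y Yy.
  by apply: pmin; [exact: lb_gen uY au _ Yy | exact: lb_gen zY bz _ Yy].
by apply: (share u a) => //; apply: le_trans ap pz.
Qed.

(** A join is the meet of the upper bounds. *)
Lemma join_exists (X : set W) : has_ubound X -> supremums X !=set0.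
Proof.
move=> /meet_exists[m [mX m_max]]; exists m; split=> // x Xx.
by apply: m_max => y; apply.
Qed.
End WeakOrder.

(** * Lower sets and the longest element *)

Section Finiteness.
Context {R : realType} {V : lmodType R} (D : root_datum V).
Local Notation W := (coxeter_group D).
Local Notation C := (pos_comb D).
Local Notation simple := (simple_roots D).
Local Notation gen := (gen D).
Local Notation l w := (@cox_length R V D w%g).
Implicit Types (v a b : V) (u x y w z : W).

Lemma inv_set_inj : injective (@inv_set R V D).
Proof.
by move=> x y e; apply: le_anti; apply/andP; split; apply/le_inv_set; rewrite e.
Qed.

(** An element below [x] is determined by its inversion set, a subset of the
    finite inversion set of [x]. *)
Lemma finite_lower x : finite_set [set z : W | (z <= x)%O].
Proof.
have [s [_ _ hs]] := inv_set_enum x.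
pose P : {fset {fset V}} := fpowerset [fset v in s]%fset.
pose g (A : {fset V}) : W := xget 1%g [set z | inv_set z = [set` A]].
apply: (@sub_finite_set _ _ (g @` [set` P])); last exact/finite_image/finite_fset.
move=> z /= /le_inv_set zx.
pose A := [fset v in s | `[< inv_set z v >]]%fset.
have eA : inv_set z = [set` A].
  apply/seteqP; split=> v /=; rewrite !inE /=.
    by move=> zv; apply/andP; split; [exact/hs/zx | exact/asboolP].
  by move=> /andP[_ /asboolP].
exists A.
  by rewrite /= fpowersetE; apply/fsubsetP => v; rewrite !inE => /andP[].
apply: inv_set_inj; rewrite eA.
exact: (xgetPex 1%g (ex_intro [set z | inv_set z = [set` A]] z eA)).
Qed.

Lemma act_neg_pos_comb w v : (forall a, simple a -> C (- act w a)) ->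
  C v -> C (- act w v).
Proof.
move=> neg [A [f [As f0 ->]]].
have -> : - act w (\sum_(a <- A) f a *: a) = \sum_(a <- A) f a *: (- act w a).
  rewrite (big_morph (fun v => - act w v) (id1 := 0) (op1 := +%R)).
  - by apply: eq_bigr => a _; rewrite actZ scalerN.
  - by move=> t t'; rewrite actD opprD.
  - by rewrite -[X in act w X](scale0r 0) actZ scale0r oppr0.
rewrite big_seq; apply: big_ind => [||a aA]; first exact: pos_comb0.
  exact: pos_combD.
by apply: pos_combZ; [exact: f0 | exact/neg/As].
Qed.

(** An element [w] of maximal length sends every simple root, hence the whole
    cone, to the negative cone. So [w^-1 v] cannot be positive for a positive
    root [v], and every positive root is an inversion of [w]. *)
Lemma max_length_top w : (forall x, (l x <= l w)%N) -> forall x, (x <= w)%O.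
Proof.
move=> wmax x; apply/le_inv_set => v /inv_setP[rv Cv _]; apply/inv_setP; split=> //.
have [Cw|//] := root_pos_neg (root_act w^-1%g rv).
exfalso; apply: (root_not_pos_neg rv Cv); rewrite -(actKV w v).
apply: act_neg_pos_comb => // a sa.
have [Ca|//] := root_pos_neg (root_act w (simple_root sa)).
by have := wmax (w * gen a)%g; rewrite (pos_ascent sa Ca) ltnn.
Qed.

Lemma finite_longest : finite_set [set: W] ->
  exists2 w : W, longest w & forall x, (x <= w)%O.
Proof.
move=> /finite_seqP[s es].
have ex : exists n, `[< exists x : W, l x = n >].
  by exists (l 1); apply/asboolP; exists 1%g.
have bd n : `[< exists x : W, l x = n >] -> (n <= \max_(x <- s) l x)%N.
  move=> /asboolP[x <-]; apply: leq_bigmax_seq => //.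
  by have : [set: W] x by []; rewrite es.
case: (ex_maxnP ex bd) => n /asboolP[w lw] w_max.
have top : forall x, (x <= w)%O.
  by apply: max_length_top => x; rewrite lw; apply: w_max; apply/asboolP; exists x.
exists w => // x xw; rewrite ltnNge; apply/negP => h.
by apply: xw; apply: le_length_eq h.
Qed.
End Finiteness.

(** * The stability relation *)

Section Stability.
Context {R : realType} {V : lmodType R} (D : root_datum V).
Local Notation W := (coxeter_group D).
Local Notation C := (pos_comb D).
Local Notation root := (Defs.roots D).
Local Notation l w := (@cox_length R V D w%g).
Implicit Types (v : V) (x y w z : W) (X L : set W).

Let coinv_not z v : coinv_set z v -> ~ inv_set z v.
Proof. by case. Qed.

Let inv_pos z v : inv_set z v -> root v /\ C v.
Proof. by case/inv_setP. Qed.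

Let coinv_pos z v : coinv_set z v -> root v /\ C v.
Proof. by case/coinv_setP. Qed.

(** If [z] permutes the coinversions of [x], so does [z^-1], which thus keeps
    them positive: they are not inversions of [z]. The remaining equality is
    decided for each positive root [v] by the signs of [z^-1 v] and of
    [x^-1 z^-1 v]. *)
Lemma stab_rel_union x z : stab_rel x z <->
  inv_set z `&` coinv_set x = set0 /\
  inv_set z `|` coinv_set x = coinv_set (z * x)%g.
Proof.
have act_zx v : act (z * x)^-1%g v = act x^-1%g (act z^-1%g v) by rewrite invgM.
have both v : root v -> C v -> C (- v) -> False by move=> rv /(root_not_pos_neg rv).
split=> [st|[dis un]].
  have to v : coinv_set x v -> coinv_set x (act z v).
    by move=> xv; rewrite -st; exists v.
  have from v : coinv_set x v -> coinv_set x (act z^-1%g v).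
    by rewrite -{1}st => -[u xu <-]; rewrite actK.
  split.
    rewrite -subset0 => v [/inv_setP[rv _ CN] /from/coinv_pos[ru Cu]].
    exact: both Cu CN.
  apply/seteqP; split=> v.
    move=> [zv|xv]; last first.
      have [rv Cv] := coinv_pos xv; apply/coinv_setP; split=> //; rewrite act_zx.
      by have /coinv_setP[] := from v xv.
    have /inv_setP[rv Cv CN] := zv; apply: coinv_setN => // /inv_setP[_ _].
    rewrite act_zx => CNx; have : coinv_set x (- act z^-1%g v).
      apply/coinv_setP; split=> //; first exact/root_opp/root_act.
      by rewrite actN.
    by move=> /to/coinv_pos[_]; rewrite actN actKV; apply: both.
  move=> /coinv_setP[rv Cv]; rewrite act_zx => Cx.
  have [Cz|CNz] := root_pos_neg (root_act z^-1%g rv); [right|left].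
    rewrite -(actKV z v); apply: to; apply/coinv_setP; split=> //.
    exact: root_act.
  exact/inv_setP.
have out v : coinv_set x v -> coinv_set x (act z v).
  move=> /coinv_setP[rv Cv Cx]; have rz := root_act z rv.
  have [Cz|CNz] := root_pos_neg rz.
    have : coinv_set (z * x)%g (act z v).
      by apply/coinv_setP; split=> //; rewrite act_zx actK.
    rewrite -un => -[/inv_setP[_ _]|//]; rewrite actK => CN.
    by case: (both _ rv Cv CN).
  have : coinv_set (z * x)%g (- act z v).
    rewrite -un; left; apply/inv_setP; split=> //; first exact: root_opp.
    by rewrite actN actK opprK.
  move=> /coinv_setP[_ _]; rewrite act_zx !actN actK => CN.
  by case: (both _ (root_act _ rv) Cx CN).
apply/seteqP; split=> v; first by move=> [u xu <-]; apply: out.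
move=> xv; have [rv Cv] := coinv_pos xv.
exists (act z^-1%g v); last exact: actKV.
apply/coinv_setP; split; first exact: root_act.
  have [//|CN] := root_pos_neg (root_act z^-1%g rv).
  suff : set0 v by [].
  by rewrite -dis; split=> //; apply/inv_setP.
have : coinv_set (z * x)%g v by rewrite -un; right.
by move=> /coinv_setP[_ _]; rewrite act_zx.
Qed.

Let le_of_union x z : inv_set z `&` coinv_set x = set0 ->
  inv_set z `|` coinv_set x `<=` coinv_set (z * x)%g ->
  [/\ (z <= x)%O, (z^-1%g <= x)%O & ((z * x)%g <= x)%O].
Proof.
move=> dis sub; split.
- apply/le_inv_set => v zv; apply: contrapT => nx; have [rv Cv] := inv_pos zv.
  suff : set0 v by [].
  by rewrite -dis; split=> //; exact: coinv_setN.
- apply/le_invP; rewrite -subset0 => v [zv]; apply/coinv_not/sub.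
  by left.
- apply/le_inv_set => v zxv; apply: contrapT => nx; have [rv Cv] := inv_pos zxv.
  by apply: coinv_not zxv; apply: sub; right; exact: coinv_setN.
Qed.

(** The condition [z^-1 <= x] makes the inversion sets of [z] and [z x] disjoint
    with cardinalities adding up to [l x]; the other two put both of them
    inside the inversion set of [x], which they therefore partition. *)
Lemma stab_rel_le x z : stab_rel x z <->
  [/\ (z <= x)%O, (z^-1%g <= x)%O & ((z * x)%g <= x)%O].
Proof.
rewrite stab_rel_union; split=> [[dis un]|].
  by apply: le_of_union => //; rewrite un.
move=> [zx zVx zxx].
have /le_inv_set sub1 := zx; have /le_inv_set sub2 := zxx; have /le_invP dis := zVx.
have ndis v : inv_set z v -> inv_set (z * x)%g v -> False.
  by move=> h1 h2; have : set0 v by rewrite -dis.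
split.
  by rewrite -subset0 => v [/sub1 xv /coinv_not].
apply/seteqP; split=> v.
  move=> [zv|xv]; [have [rv Cv] := inv_pos zv | have [rv Cv] := coinv_pos xv].
    by apply: coinv_setN => //; exact: ndis.
  by apply: coinv_setN => // /sub2; exact: coinv_not.
move=> zxv; have [rv Cv] := coinv_pos zxv.
have [xv|nx] := pselect (inv_set x v); last by right; exact: coinv_setN.
left; have [s [us ss hs]] := inv_set_enum z.
have [t [ut st ht]] := inv_set_enum (z * x)%g; have [r [ur sr hr]] := inv_set_enum x.
have ust : uniq (s ++ t).
  rewrite cat_uniq us ut andbT; apply/hasPn => u /ht tu; apply/negP => /hs su.
  exact: ndis su tu.
have str : {subset s ++ t <= r}.
  by move=> u; rewrite mem_cat => /orP[/hs/sub1/hr|/ht/sub2/hr].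
have size_r : (size r <= size (s ++ t))%N.
  by move: zVx; rewrite size_cat ss st sr leE invgK lengthV => /eqP ->.
have := (uniq_min_size ust str size_r).2 v; rewrite mem_cat.
move/hr: (xv) => -> /orP[/hs//|/ht]; by move/coinv_not: zxv.
Qed.

Lemma coinv_closed z : root_closed D (coinv_set z).
Proof.
split=> [v /coinv_pos[]//|al be /coinv_setP[_ Ca Cza] /coinv_setP[_ Cb Czb] a b a0 b0 rab].
apply/coinv_setP; split=> //; first by apply: pos_combD; apply: pos_combZ.
by rewrite actD !actZ; apply: pos_combD; apply: pos_combZ.
Qed.

(** The closure contains the union and a coinversion set is closed. Conversely the
    inclusion of the union in the coinversion set of [z x] already gives the
    three inequalities of [stab_rel_le]. *)
Lemma closure_iff_union x z :
  root_closure D (coinv_set x `|` inv_set z) = coinv_set (z * x)%g /\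
    coinv_set x `&` inv_set z = set0 <->
  inv_set z `&` coinv_set x = set0 /\
    inv_set z `|` coinv_set x = coinv_set (z * x)%g.
Proof.
rewrite [coinv_set x `|` _]setUC [coinv_set x `&` _]setIC.
split=> [[cl dis]|[dis un]]; last first.
  by split=> //; rewrite un; apply/smallest_id/coinv_closed.
apply/stab_rel_union/stab_rel_le/le_of_union => //.
by rewrite -cl; exact: sub_gen_smallest.
Qed.

Lemma stab_relV x z : stab_rel x z -> stab_rel x z^-1%g.
Proof.
rewrite /stab_rel => st; rewrite -{1}st image_comp.
by rewrite -[RHS]image_id; apply: eq_imagel => v _; exact: actK.
Qed.

Lemma stab_rel1 x : stab_rel x 1%g.
Proof. exact: image_id. Qed.

Lemma stab_relM x y z : stab_rel x y -> stab_rel x z -> stab_rel x (y * z)%g.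
Proof.
rewrite /stab_rel => sy sz; rewrite -[RHS]sy -[in RHS]sz image_comp.
by apply: eq_imagel.
Qed.

Lemma dagger_group X : group_closed (mem (dagger X)).
Proof.
split=> [|y z]; rewrite !inE; first by move=> x _; exact: stab_rel1.
by move=> yX zX x Xx; apply: stab_relM; [exact: yX | exact/stab_relV/zX].
Qed.

Lemma dagger_finite X : X !=set0 -> finite_set (dagger X).
Proof.
move=> [x Xx]; apply: sub_finite_set (finite_lower x) => z /(_ x Xx).
by case/stab_rel_le.
Qed.

(** Each of the elements [z], [z^-1] and [z m] is a lower bound of [Y]; for the
    last one, [z m <= z y <= y] because translation by [z] is monotone above
    [z^-1]. *)
Lemma star_meet Z Y m : Y `<=` star Z -> Y !=set0 -> infimums Y m -> star (Z : set W) m.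
Proof.
move=> YL [y0 Yy0] [mY m_max] z Zz.
have st y : Y y -> [/\ (z <= y)%O, (z^-1%g <= y)%O & ((z * y)%g <= y)%O].
  by move=> /YL/(_ z Zz)/stab_rel_le.
have zVm : (z^-1%g <= m)%O by apply: m_max => y /st[].
apply/stab_rel_le; split=> //; first by apply: m_max => y /st[].
apply: m_max => y Yy; have [_ zVy zyy] := st y Yy; apply: le_trans zyy.
by have := le_divgl zVm zVy; rewrite invgK => ->; apply: mY.
Qed.

(** Translation by [z] maps the elements between [z^-1] and [x] isomorphically
    onto those below [z x], so [z x] is the join of the elements [z y] with [y]
    in [X]. As [z y <= y <= x], it is below [x]. *)
Lemma star_join Z X x : X `<=` star Z -> X !=set0 -> supremums X x -> star (Z : set W) x.
Proof.
move=> XL [x0 Xx0] [xX x_min] z Zz.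
have st y : X y -> [/\ (z <= y)%O, (z^-1%g <= y)%O & ((z * y)%g <= y)%O].
  by move=> /XL/(_ z Zz)/stab_rel_le.
have [z0 zV0 _] := st x0 Xx0; have x0x := xX _ Xx0.
have zVx := le_trans zV0 x0x.
apply/stab_rel_le; split=> //; first exact: le_trans z0 x0x.
have x_ub : ubound [set (z * y)%g | y in X] x.
  by move=> _ [y Xy <-]; have [_ _ h] := st y Xy; exact: le_trans h (xX _ Xy).
have [q [qX q_min]] := join_exists (ex_intro _ x x_ub).
apply: le_trans (q_min _ x_ub).
have q_zx : (q <= (z * x)%g)%O.
  apply: q_min => _ [y Xy <-]; have [_ zVy _] := st y Xy.
  by have := le_divgl zVy zVx; rewrite invgK => ->; apply: xX.
have zVq : (z^-1%g <= (z^-1 * q)%g)%O by apply: (le_mulg zVx); rewrite invgK.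
have : (x <= (z^-1 * q)%g)%O.
  apply: x_min => y Xy; have [_ zVy _] := st y Xy.
  by rewrite -(le_divgl zVy zVq) invgK mulVKg; apply: qX; exists y.
by rewrite -(le_divgl zVx zVq) invgK mulVKg.
Qed.

Lemma star_setT_infinite : infinite_set [set: W] -> star [set: W] = set0.
Proof.
move=> inf; rewrite -subset0 => x xT; apply: inf.
by apply: sub_finite_set (finite_lower x) => z _; have /stab_rel_le[] := xT z I.
Qed.

Lemma star_setT_finite : finite_set [set: W] ->
  exists2 wS : W, longest wS & star [set: W] = [set wS].
Proof.
move=> /finite_longest[w lw top]; exists w => //.
apply/seteqP; split=> [x xT|_ -> z _]; last by apply/stab_rel_le; split.
by apply: le_anti; rewrite top; have /stab_rel_le[] := xT w I.
Qed.

Lemma stab_rel_involution w : involutions D w -> stab_rel w w.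
Proof.
move=> ww; have wV : (w^-1 = w)%g by rewrite -[RHS]mulg1 -(mulgV w) mulgA ww mul1g.
by apply/stab_rel_le; rewrite wV ww; split=> //; rewrite leE length1 invg1 mul1g.
Qed.

Lemma star_involution_min w x : star [set w] x -> (w <= x)%O.
Proof. by move=> /(_ w erefl)/stab_rel_le[]. Qed.
End Stability.

Theorem theorem9p2 (R : realType) (V : lmodType R) (D : root_datum V) :
  let W := coxeter_group D in
  (forall x z : W,
     (stab_rel x z <->
      root_closure D (coinv_set x `|` inv_set z) = coinv_set (z * x)%g /\
      coinv_set x `&` inv_set z = set0) /\
     (root_closure D (coinv_set x `|` inv_set z) = coinv_set (z * x)%g /\
      coinv_set x `&` inv_set z = set0 <->
      inv_set z `&` coinv_set x = set0 /\
      inv_set z `|` coinv_set x = coinv_set (z * x)%g)) /\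
  (forall x z : W, stab_rel x z ->
     [/\ (z <= x)%O,
         (cox_length x)%:Z - (cox_length z)%:Z = (cox_length (z^-1 * x)%g)%:Z &
         stab_rel x z^-1%g]) /\
  (forall G : set W, stable_subgroups D G -> G <> setT ->
     group_closed (mem G) /\ finite_set G) /\
  ((forall L : set W, stable_subsemilattices D L ->
      complete_meet_subsemilattice L) /\
   (infinite_set [set: W] -> star [set: W] = set0) /\
   (finite_set [set: W] ->
      exists2 wS : W, longest wS & star [set: W] = [set wS])) /\
  (forall L : set W, stable_subsemilattices D L ->
   (* X is nonempty: the join of set0 is 1, which in general is not in L. *)
   forall X : set W, X `<=` L -> X !=set0 -> has_ubound X ->
     exists x : W, [/\ supremums X x, L x &
       (ubound X `&` L `&` lbound (ubound X `&` L)) x]) /\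
  ((forall w : W, involutions D w ->
      [/\ stab_rel w w,
          [/\ stable_subgroups D (dagger (star [set w])),
              group_closed (mem (dagger (star [set w]))),
              dagger (star [set w]) `<=` [set x | (x <= w)%O] &
              dagger (star [set w]) w] &
          star [set w] `<=` [set x | (w <= x)%O] /\ star [set w] w]) /\
   set_fun (involutions D) (stable_subsemilattices D `\ set0)
     (fun w : W => star [set w]) /\
   set_inj (involutions D) (fun w : W => star [set w])).
Proof.
move=> W; split.
  move=> x z; split; last exact: closure_iff_union.
  exact: iff_trans (stab_rel_union x z) (iff_sym (closure_iff_union x z)).
split.
  move=> x z st; have /stab_rel_le[zx _ _] := st; split=> //; last exact: stab_relV.
  by move: zx; rewrite leE => /eqP ->; rewrite PoszD addrC addKr.
split.
  move=> _ [X _ <-] XT; split; first exact: dagger_group.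
  apply: dagger_finite; apply/set0P; apply/eqP => X0; apply: XT.
  by rewrite X0; apply/seteqP; split=> z // _ x [].
split.
  split=> [_ [Z _ <-] Y YL Y0|].
    by have [m Ym] := meet_exists Y0; exists m => //; apply: star_meet Ym.
  split; [exact: star_setT_infinite | exact: star_setT_finite].
split.
  move=> _ [Z _ <-] X XL X0 Xub; have [x Xx] := join_exists Xub.
  have Lx := star_join XL X0 Xx; have [xX x_min] := Xx.
  by exists x; split=> //; split=> // y [yX _]; apply: x_min.
have star_self (w : W) : involutions D w -> star [set w] w.
  by move=> ww _ ->; exact: stab_rel_involution.
split=> [w ww|].
  have ww' := star_self w ww; split; first exact: stab_rel_involution.
  - split; first by exists (star [set w]).
    + exact: dagger_group.
    + by move=> z /(_ w ww') /stab_rel_le[].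
    + by move=> x; apply.
  - by split=> // x /star_involution_min.
split=> [w ww|w w'].
  split; first by exists [set w].
  by move=> /= w0; have := star_self w ww; rewrite w0.
rewrite !inE => ww ww' e; apply: le_anti; apply/andP.
split; apply: star_involution_min.
  by rewrite e; exact: star_self.
by rewrite -e; exact: star_self.
Qed.
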